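(* Let $n$ be a positive integer. The coherent configuration $\mathcal C_2$ on $X=\{0,1\}^n$ associated with the Terwilliger algebra of the binary Hamming scheme $H(n,2)$ is $P$-polynomial.
   Context: **Coherent configurations.** A coherent configuration is a pair $\mathcal C=(X,\mathcal R)$, where $X$ is a nonempty finite set and $\mathcal R=\{R_i\mid i\in I\}$ is a partition of $X\times X$ into nonempty sets such that: if $R_i$ meets $\operatorname{diag}(X\times X)=\{(x,x)\mid x\in X\}$ then $R_i\subseteq\operatorname{diag}(X\times X)$; the transpose of each $R_i$ is in $\mathcal R$; and for all $i,j,h\in I$ the number $|\{z\in X\mid (x,z)\in R_i,(z,y)\in R_j\}|$ does not depend on the choice of $(x,y)\in R_h$. The fibers $X_i$ ($i\in\Omega$) are the classes of the partition of $X$ determined by the relations contained in the diagonal; each relation is contained in a single $X_i\times X_j$. Put $\varepsilon_{i,j}=1-\delta_{i,j}$. The relations in $X_i\times X_j$ are numbered $R^{(i,j)}_\ell$, $\varepsilon_{i,j}\le\ell\le r_{i,j}$, with $R_0^{(i,i)}=\operatorname{diag}(X_i\times X_i)$ and with $R^{(j,i)}_\ell$ the transpose of $R^{(i,j)}_\ell$; put $\widetilde r_{i,j}=r_{i,j}-\varepsilon_{i,j}$. Let $A^{(i,j)}_\ell$ be the adjacency matrix of $R^{(i,j)}_\ell$ (indexed by $X\times X$, or equivalently, as a block, by $X_i\times X_j$), and $\mathcal A^{(i,j)}=\operatorname{span}_{\mathbb C}\{A_\ell^{(i,j)}\}$. **Eigenvalues.** One considers coherent configurations whose fibers carry symmetric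 association schemes and for which there are matrices $E_h^{(i,j)}$ ($i,j\in\Omega$, $0\le h\le\widetilde r_{i,j}$) such that: (B1) $E_0^{(i,j)}=\frac1{\sqrt{|X_i||X_j|}}J$ on the block $X_i\times X_j$ ($J$ all-ones); (B2) $\{E_h^{(i,j)}\}_{h}$ is a basis of $\mathcal A^{(i,j)}$; (B3) the transpose of $E_\ell^{(i,j)}$ is $E_\ell^{(j,i)}$; (B4) $E_\ell^{(i,j)}E_{\ell'}^{(i',j')}=\delta_{j,i'}\delta_{\ell,\ell'}E_\ell^{(i,j')}$. The eigenvalues $P_\ell^{(i,j)}(h)$ are defined by $A_\ell^{(i,j)}=\sum_{h=0}^{\widetilde r_{i,j}}P_\ell^{(i,j)}(h)E_h^{(i,j)}$. **$P$-polynomial.** Such a configuration is $P$-polynomial if for every $i,j\in\Omega$ there is an ordering $A^{(i,j)}_{\varepsilon_{i,j}},\dots,A^{(i,j)}_{r_{i,j}}$ of the adjacency matrices of the block (with $A_0^{(i,i)}$ the identity of $X_i$) such that $P^{(i,j)}_{\varepsilon_{i,j}}(h)\ne0$ for all $0\le h\le\widetilde r_{i,j}$ and, with $\overline{P_\ell^{(i,j)}}(h)=P_\ell^{(i,j)}(h)/P_{\varepsilon_{i,j}}^{(i,j)}(h)$, there are polynomials $v^{(i,j)}_\ell$ ($\varepsilon_{i,j}\le\ell\le r_{i,j}$) with $\deg v_\ell^{(i,j)}=\ell-\varepsilon_{i,j}$ and $\overline{P_\ell^{(i,j)}}(h)=v_\ell^{(i,j)}\bigl(\overline{P_{1+\varepsilon_{i,j}}^{(i,j)}}(h)\bigr)$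 for all $0\le h\le\widetilde r_{i,j}$. (If $\widetilde r_{i,j}=0$ the polynomial condition is trivial.) **The configuration $\mathcal C_2$.** For $0\le i\le n$ let $X_i$ be the set of $x\in\{0,1\}^n$ of Hamming weight $i$, and let $\operatorname{supp}(x)=\{m\mid x_m=1\}$. For $i,j\in\{0,\dots,n\}$ put $d_{i,j}=\min\{i,j,n-i,n-j\}$, and for $\varepsilon_{i,j}\le\ell\le d_{i,j}+\varepsilon_{i,j}$ let $$R_\ell^{(i,j)}=\{(x,y)\in X_i\times X_j\mid \ell=\min\{i,j\}+\varepsilon_{i,j}-|\operatorname{supp}(x)\cap\operatorname{supp}(y)|\}.$$ Then $\mathcal C_2=(X,\{R_\ell^{(i,j)}\})$, with fibers $X_0,\dots,X_n$ and $\widetilde r_{i,j}=d_{i,j}$; it is a coherent configuration whose fibers carry symmetric association schemes and which admits matrices $E_h^{(i,j)}$ ($0\le i,j\le n$, $0\le h\le\widetilde r_{i,j}$) such that $E_0^{(i,j)}=\frac1{\sqrt{|X_i||X_j|}}J$ on the block $X_i\times X_j$, $\{E_h^{(i,j)}\}_h$ is a basis of $\mathcal A^{(i,j)}$, the transpose of $E_\ell^{(i,j)}$ is $E_\ell^{(j,i)}$, and $E_\ell^{(i,j)}E_{\ell'}^{(i',j')}=\delta_{j,i'}\delta_{\ell,\ell'}E_\ell^{(i,j')}$. *)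

(* Defs.v *)
From mathcomp Require Import all_boot all_order all_algebra.
From mathcomp Require Import reals.
From mathcomp Require Export complex.

Set Implicit Arguments.
Unset Strict Implicit.
Unset Printing Implicit Defensive.

Import Order.TTheory GRing.Theory Num.Theory.
Local Open Scope ring_scope.

Section CoherentConfigurations.
Variable X : finType.
Implicit Types (R S T : {set X * X}) (Rs : {set {set X * X}}) (F : {set X}).

Definition diagonal F : {set X * X} := [set p | (p.1 \in F) && (p.1 == p.2)].

Definition transpose R : {set X * X} := [set p | (p.2, p.1) \in R].

Definition intersection_number R S (p : X * X) : nat :=
  #|[set z | ((p.1, z) \in R) && ((z, p.2) \in S)]|.

Definition coherent_configuration Rs : Prop :=
  [/\ (0 < #|X|)%N,
      partition Rs [set: X * X],
      forall R, R \in Rs -> R :&: diagonal setT != set0 ->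
        R \subset diagonal setT,
      forall R, R \in Rs -> transpose R \in Rs
    & forall R S T, R \in Rs -> S \in Rs -> T \in Rs ->
        {in T &, forall p q, intersection_number R S p = intersection_number R S q}].

Definition fibers Rs : {set {set X}} := [set F | diagonal F \in Rs].

(* The relations of a coherent configuration inside F x F always form a
   (possibly non-commutative, non-symmetric) association scheme on F. *)
Definition symmetric_fibers Rs : Prop :=
  forall F R, F \in fibers Rs -> R \in Rs -> R \subset setX F F ->
    transpose R = R.

End CoherentConfigurations.

(* Fibers X_i (i in Omega), and relations R^(i,j)_l for eps_{i,j} <= l <= r_{i,j}.
   Only these values of l matter: nblock_rel is arbitrary outside this range. *)
Record numbered_config (X Omega : finType) := NumberedConfig {
  nfiber : Omega -> {set X};
  nmax : Omega -> Omega -> nat;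
  nblock_rel : Omega -> Omega -> nat -> {set X * X}
}.

Section PPolynomial.
Variables (X Omega : finType) (K : numbered_config X Omega).
Implicit Types (i j : Omega) (l : nat).

Definition eps i j : nat := (i != j).

Definition rtilde i j : nat := nmax K i j - eps i j.

Definition block_range i j : seq nat :=
  [seq l <- iota 0 (nmax K i j).+1 | (eps i j <= l)%N].

Definition relations : {set {set X * X}} :=
  [set R | [exists i, [exists j,
     has (fun l => R == nblock_rel K i j l) (block_range i j)]]].

Definition well_numbered : Prop :=
  [/\ injective (nfiber K) /\ fibers relations = [set nfiber K i | i : Omega],
      forall i j, nmax K i j = nmax K j i,
      forall i j, {in block_range i j,
        forall l, nblock_rel K i j l \subset setX (nfiber K i) (nfiber K j)},
      forall i j, {in block_range i j &, injective (nblock_rel K i j)}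
    & (forall i, nblock_rel K i i 0%N = diagonal (nfiber K i)) /\
      (forall i j, {in block_range i j,
        forall l, nblock_rel K j i l = transpose (nblock_rel K i j l)})].

Variable C : numClosedFieldType.

(* Matrices indexed by X x X, through the enumeration of X. *)
Definition adjacency (R : {set X * X}) : 'M[C]_(#|X|) :=
  \matrix_(a, b) ((enum_val a, enum_val b) \in R)%:R.

Definition A_ i j l : 'M[C]_(#|X|) := adjacency (nblock_rel K i j l).

(* The span of the A^(i,j)_l. *)
Definition A_space i j : {vspace 'M[C]_(#|X|)} :=
  <<[seq A_ i j l | l <- block_range i j]>>%VS.

Definition E_tuple (E : Omega -> Omega -> nat -> 'M[C]_(#|X|)) i j :
    (rtilde i j).+1.-tuple 'M[C]_(#|X|) :=
  [tuple E i j h | h < (rtilde i j).+1].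

(* (B1)-(B4). The first part of (B4) says that the index l on the right-hand
   side E^(i,j')_l is in range whenever the Kronecker deltas do not vanish. *)
Definition eigen_matrices (E : Omega -> Omega -> nat -> 'M[C]_(#|X|)) : Prop :=
  [/\ forall i j, E i j 0%N =
        (sqrtC (#|nfiber K i| * #|nfiber K j|)%:R)^-1 *:
          adjacency (setX (nfiber K i) (nfiber K j)),
      forall i j, basis_of (A_space i j) (E_tuple E i j),
      forall i j l, (l <= rtilde i j)%N -> (E i j l)^T = E j i l
    & (forall i j j' l, (l <= rtilde i j)%N -> (l <= rtilde j j')%N ->
         (l <= rtilde i j')%N) /\
      (forall i j i' j' l l', (l <= rtilde i j)%N -> (l' <= rtilde i' j')%N ->
         E i j l *m E i' j' l' = ((j == i') && (l == l'))%:R *: E i j' l)].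

(* P^(i,j)_l(h): the coefficient of E^(i,j)_h in the expansion of A^(i,j)_l. *)
Definition P_eigenvalue (E : Omega -> Omega -> nat -> 'M[C]_(#|X|)) i j l
    (h : 'I_(rtilde i j).+1) : C :=
  coord (E_tuple E i j) h (A_ i j l).

(* s is the ordering A_{s eps}, ..., A_{s r} of the matrices of the block.
   When rtilde i j = 0, the index s (1 + eps) is out of range, but v (eps) is
   then the only polynomial involved, and it is constant. *)
Definition P_polynomial_block (E : Omega -> Omega -> nat -> 'M[C]_(#|X|)) i j :
    Prop :=
  let P := P_eigenvalue E (i := i) (j := j) in
  let e := eps i j in
  exists s : nat -> nat,
    let Pbar l h := P (s l) h / P (s e) h in
    [/\ perm_eq [seq s l | l <- block_range i j] (block_range i j),
        i = j -> s 0%N = 0%N,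
        forall h, P (s e) h != 0
      & exists v : nat -> {poly C}, {in block_range i j, forall l,
          size (v l) = (l - e).+1 /\
          forall h, Pbar l h = (v l).[Pbar e.+1 h]}].

(* The E^(i,j)_h are determined by (B1)-(B4) only up to signs and a relabelling
   of the indices h; the condition on the blocks does not depend on the choice,
   so it is required for all of them, along with their existence. *)
Definition P_polynomial : Prop :=
  [/\ coherent_configuration relations,
      well_numbered,
      symmetric_fibers relations,
      exists E, eigen_matrices E
    & forall E, eigen_matrices E -> forall i j, P_polynomial_block E i j].

End PPolynomial.

Section BinaryHamming.
Variable n : nat.

Definition supp (x : n.-tuple bool) : {set 'I_n} := [set m | tnth x m].

Definition C2_fiber (i : 'I_n.+1) : {set n.-tuple bool} :=
  [set x | #|supp x| == i].

Definition C2_d (i j : 'I_n.+1) : nat := minn (minn i j) (minn (n - i) (n - j)).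

(* On C2_fiber i x C2_fiber j the truncated subtraction is exact. *)
Definition C2_rel (i j : 'I_n.+1) (l : nat) : {set n.-tuple bool * n.-tuple bool} :=
  [set p in setX (C2_fiber i) (C2_fiber j) |
     l == (minn i j + eps i j - #|supp p.1 :&: supp p.2|)%N].

Definition C2 : numbered_config (n.-tuple bool) 'I_n.+1 :=
  NumberedConfig C2_fiber (fun i j => C2_d i j + eps i j)%N C2_rel.

End BinaryHamming.

(* Main.v *)
Require Import Defs.
From mathcomp Require Import all_boot all_order all_algebra.
From mathcomp Require Import reals complex.
From mathcomp Require Import fingroup perm zify ring.

Set Implicit Arguments.
Unset Strict Implicit.
Unset Printing Implicit Defensive.

(** Write w(x) for the weight of a word and o(x, y) for the number of common
    ones of x and y.  The symmetric group acting on the coordinates is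
    transitive on the pairs (x, y) with given w(x), w(y) and o(x, y)
    ([permute_transitive]), so the relations of the configuration are its
    orbits on pairs.  This yields coherence, and it shows that a matrix with
    support in the block X_i x X_j lies in the span of the A_l^(i,j) as soon as
    it is invariant under the group ([block_expansion], [mem_A_space]);
    products of invariant matrices are invariant.

    Eigenvalues.  Let matrices E satisfying (B1)-(B4) be given.  The matrix
    A_1^(i,i) relates two words of weight i that differ by exchanging a one and
    a zero.  Such an exchange changes the overlap with a fixed word y by at
    most one, and it can increase the overlap unless the latter is maximal.
    Hence A_1^(i,i) A_l^(i,j) is a combination of the A_l'^(i,j) with
    l' <= l + 1, where the coefficient of A_{l+1}^(i,j) is not zero
    ([mul_A1]).  If theta_h is the eigenvalue of A_1^(i,i) on E_h, comparing
    coordinates gives P_{eps+k}(h) = u_k(theta_h) P_eps(h) with deg u_k = k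
    ([P_polynomial_theta]).  In particular P_eps(h) <> 0, since otherwise the
    coordinate along E_h would vanish on the whole block ([P_eps_neq0]), and
    the polynomials v_{eps+k} are obtained from the u_k by the affine
    substitution that inverts u_1.  Everything works for the natural ordering
    of the relations.

    Existence of E.  Let W be the matrix of the cover relation of the Boolean
    lattice.  On matrices whose rows are supported on weight b it satisfies the
    sl_2 relation W W^T = W^T W + (n - 2b) ([cover_commutator]).  For 2h <= n
    the space of invariant matrices H on X_h x X_h with W H = 0 is a line,
    because this equation is a first order recurrence for the entries in terms
    of the overlap ([cover_harmonic], [harmonic_unique]).  As H H lies on the
    same line, a suitable multiple H_h of H is a nonzero symmetric idempotent.
    The sl_2 relation gives W^a (W^T)^a H_h = K_a H_h with an explicit K_a > 0
    and W^b (W^T)^a H_h = 0 for b > a ([iter_cover_tower],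
    [iter_cover_tower0]), which is precisely what is needed for
      E_h^(i,j) = (K_{i-h} K_{j-h})^(-1/2) (W^T)^(i-h) H_h W^(j-h)
    to satisfy (B4).  Freeness follows from (B4), and the dimension of the
    block then makes the E_h^(i,j) a basis. *)

Import Order.TTheory GRing.Theory Num.Theory.
Local Open Scope ring_scope.

(** * Orbits of the symmetric group on pairs of words *)

Section Orbits.
Variable n : nat.
Implicit Types (x y z : n.-tuple bool) (m k : 'I_n) (s : 'S_n).

Definition weight x : nat := #|supp x|.
Definition overlap x y : nat := #|supp x :&: supp y|.

Lemma in_supp x m : (m \in supp x) = tnth x m.
Proof. by rewrite inE. Qed.

Lemma supp_inj : injective (@supp n).
Proof.
move=> x y exy; apply/eq_from_tnth => m.
by rewrite -!in_supp exy.
Qed.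

Lemma overlapC x y : overlap x y = overlap y x.
Proof. by rewrite /overlap setIC. Qed.

Lemma overlapxx x : overlap x x = weight x.
Proof. by rewrite /overlap setIid. Qed.

Lemma overlap_leql x y : (overlap x y <= weight x)%N.
Proof. exact/subset_leq_card/subsetIl. Qed.

Lemma overlap_leqr x y : (overlap x y <= weight y)%N.
Proof. exact/subset_leq_card/subsetIr. Qed.

Lemma weight_leq x : (weight x <= n)%N.
Proof. by rewrite -[leqRHS]card_ord max_card. Qed.

Lemma overlap_geq x y : (weight x + weight y <= n + overlap x y)%N.
Proof.
rewrite /weight -cardsUI leq_add2r -[leqRHS]card_ord; exact: max_card.
Qed.

Lemma overlap_subset x y : (overlap x y == weight x) = (supp x \subset supp y).
Proof.
apply/eqP/idP => [e|/setIidPl]; last by rewrite /overlap => ->.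
by apply/setIidPl/eqP; rewrite eqEcard subsetIl; move: e;
  rewrite /overlap /weight => ->; rewrite leqnn.
Qed.

Lemma overlap_eq x y :
  overlap x y = weight x -> weight x = weight y -> x = y.
Proof.
move=> /eqP; rewrite overlap_subset => sxy e; apply/supp_inj/eqP.
by rewrite eqEcard sxy; move: e; rewrite /weight => ->; rewrite leqnn.
Qed.

Definition permute s x : n.-tuple bool := [tuple tnth x (s m) | m < n].

Lemma permuteKV s : cancel (permute s) (permute s^-1%g).
Proof. by move=> x; apply/eq_from_tnth => m; rewrite !tnth_mktuple permKV. Qed.

Lemma permuteVK s : cancel (permute s^-1%g) (permute s).
Proof. by move=> x; apply/eq_from_tnth => m; rewrite !tnth_mktuple permK. Qed.

Lemma supp_permute s x : supp (permute s x) = s @^-1: supp x.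
Proof. by apply/setP => m; rewrite !inE tnth_mktuple. Qed.

Lemma weight_permute s x : weight (permute s x) = weight x.
Proof. by rewrite /weight supp_permute card_preimset //; apply: perm_inj. Qed.

Lemma overlap_permute s x y : overlap (permute s x) (permute s y) = overlap x y.
Proof.
by rewrite /overlap !supp_permute -preimsetI card_preimset //; apply: perm_inj.
Qed.

(** The coordinates m are coloured by (x_m, y_m).  The three numbers
    determine the sizes of all four colour classes, so the two colourings
    differ by a permutation. *)
Lemma permute_transitive x y x' y' :
    weight x = weight x' -> weight y = weight y' ->
    overlap x y = overlap x' y' ->
  exists s, permute s x = x' /\ permute s y = y'.
Proof.
move=> ex ey exy.
pose t z1 z2 : n.-tuple (bool * bool) := [tuple (tnth z1 m, tnth z2 m) | m < n].
pose r z1 z2 b : nat :=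
  #|(if b.1 then supp z1 else ~: supp z1) :&:
    (if b.2 then supp z2 else ~: supp z2)|.
have cnt z1 z2 b : count_mem b (t z1 z2) = r z1 z2 b.
  rewrite /t /r /= count_map -sum1_card -sum1_count big_mkcond [RHS]big_mkcond
    /=.
  rewrite big_enum /=; apply: eq_bigr => m _.
  by case: b => [[] []]; rewrite !inE xpair_eqE; case: (tnth _ _);
    case: (tnth _ _).
have venn z1 z2 : [/\ r z1 z2 (true, true) = overlap z1 z2,
    (overlap z1 z2 + r z1 z2 (true, false) = weight z1)%N,
    (overlap z1 z2 + r z1 z2 (false, true) = weight z2)%N &
    (weight z1 + (r z1 z2 (false, true) + r z1 z2 (false, false)) = n)%N].
  split=> //.
  - by rewrite /r /= -setDE cardsID.
  - by rewrite /r /= [~: _ :&: _]setIC -setDE overlapC cardsID.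
  - by rewrite /r /= -setDE cardsID cardsC card_ord.
have er b : r x' y' b = r x y b.
  have [h0 h1 h2 h3] := venn x y; have [h4 h5 h6 h7] := venn x' y'.
  by case: b => [[] []]; lia.
have /tuple_permP[s es] : perm_eq (t x' y') (t x y).
  by apply/allP => b _ /=; rewrite !cnt er.
move/val_inj: es => es.
exists s; split; apply/eq_from_tnth => m; move/(congr1 ((@tnth _ _)^~ m)): es;
  by rewrite !tnth_mktuple => -[].
Qed.

End Orbits.

(** * Words with prescribed weights and overlap *)

Section PairsExist.
Variable n : nat.
Implicit Types (x y z : n.-tuple bool) (m k : 'I_n).

Definition segment (a b : nat) : n.-tuple bool :=
  [tuple (a <= m < b)%N | m < n].

Lemma weight_segment a b : (b <= n)%N -> weight (segment a b) = (b - a)%N.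
Proof.
move=> leb; rewrite /weight -sum1_card.
under eq_bigl => m do rewrite in_supp tnth_mktuple.
rewrite -(big_mkord (fun t => a <= t < b)%N (fun=> 1%N)).
rewrite -[RHS]muln1 -sum_nat_const_nat.
rewrite (@big_nat_widen _ _ _ a b n) // (@big_nat_widenl _ _ _ a 0 n) //.
by apply: eq_bigl => t /=; rewrite andbC.
Qed.

(** The bounds on s are the only constraints: an interval of length b sliding
    along the coordinates meets an initial interval of length a in any number
    of points that they permit. *)
Lemma exists_pair a b s :
    (s <= a)%N -> (s <= b)%N -> (a + b <= n + s)%N ->
  exists x y, [/\ weight x = a, weight y = b & overlap x y = s].
Proof.
move=> sa sb ab; exists (segment 0 a), (segment (a - s) (a + b - s)).
split; rewrite ?weight_segment //; try lia.
suff -> : overlap (segment 0 a) (segment (a - s) (a + b - s)) =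
    weight (segment (a - s) a) by rewrite weight_segment; lia.
rewrite /overlap /weight; apply: eq_card => m.
by rewrite !inE !tnth_mktuple; lia.
Qed.

Definition flip x m : n.-tuple bool := [tuple (k == m) (+) tnth x k | k < n].

Lemma flipK m : involutive (flip^~ m).
Proof. by move=> x; apply/eq_from_tnth => k; rewrite !tnth_mktuple addKb. Qed.

Lemma flipC x m k : flip (flip x m) k = flip (flip x k) m.
Proof. by apply/eq_from_tnth => j; rewrite !tnth_mktuple addbCA. Qed.

Lemma tnth_flip x m k : tnth (flip x m) k = (k == m) (+) tnth x k.
Proof. exact: tnth_mktuple. Qed.

Lemma supp_flip1 x m : ~~ tnth x m -> supp (flip x m) = m |: supp x.
Proof.
move=> xm; apply/setP => k; rewrite !inE tnth_flip.
by case: eqP => //= ->; rewrite (negPf xm).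
Qed.

Lemma supp_flip0 x m : tnth x m -> supp (flip x m) = supp x :\ m.
Proof.
move=> xm; apply/setP => k; rewrite !inE tnth_flip.
by case: eqP => //= ->; rewrite xm.
Qed.

Lemma weight_flip1 x m : ~~ tnth x m -> weight (flip x m) = (weight x).+1.
Proof. by move=> xm; rewrite /weight supp_flip1 // cardsU1 in_supp xm. Qed.

Lemma weight_flip0 x m : tnth x m -> (weight (flip x m)).+1 = weight x.
Proof.
by move=> xm; rewrite /weight supp_flip0 // [RHS](cardsD1 m) in_supp xm.
Qed.

Lemma overlap_flip1 x y m : ~~ tnth x m ->
  overlap (flip x m) y = (overlap x y + tnth y m)%N.
Proof.
move=> xm; rewrite /overlap supp_flip1 // setIUl.
case ym: (tnth y m).
  have -> : [set m] :&: supp y = [set m].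
    by apply/setIidPl; rewrite sub1set in_supp.
  by rewrite cardsU1 inE in_supp (negPf xm) addn1.
have -> : [set m] :&: supp y = set0.
  by apply/setP => k; rewrite !inE; case: eqP => //= ->.
by rewrite set0U addn0.
Qed.

Lemma overlap_flip0 x y m : tnth x m ->
  overlap x y = (overlap (flip x m) y + tnth y m)%N.
Proof.
move=> xm; rewrite -{1}(flipK m x) overlap_flip1 //.
by rewrite tnth_flip eqxx xm.
Qed.

End PairsExist.

(** * The coherent configuration *)

Section Config.
Variable n : nat.
Implicit Types (x y z : n.-tuple bool) (i j : 'I_n.+1) (l : nat).
Implicit Types (p q : n.-tuple bool * n.-tuple bool).

(** The complete invariant of the orbit of a pair. *)
Definition pair_type p := (weight p.1, weight p.2, overlap p.1 p.2).

Definition orbital p := [set q | pair_type q == pair_type p].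

Definition fiber_index x : 'I_n.+1 := Ordinal (n:=n.+1) (weight_leq x).

Lemma weight0_segment x : weight x = 0%N -> x = segment n 0 0.
Proof.
move=> wx; have w0 : weight (segment n 0 0) = 0%N by rewrite weight_segment.
apply: overlap_eq; rewrite ?wx ?w0 //.
by have := overlap_leql x (segment n 0 0); lia.
Qed.

Lemma mem_fiber i x : (x \in C2_fiber i) = (weight x == i).
Proof. by rewrite inE. Qed.

Lemma C2_block_range i j :
  block_range (C2 n) i j = iota (eps i j) (C2_d i j).+1.
Proof.
rewrite /block_range [nmax _ _ _]/= -addSn addnC iotaD add0n filter_cat.
rewrite (_ : filter _ (iota 0 _) = [::]).
  by apply/all_filterP/allP => l; rewrite mem_iota => /andP[].
by apply/eqP; rewrite -size_eq0 size_filter -leqn0 leqNgt -has_count;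
  apply/hasPn => l; rewrite mem_iota add0n -ltnNge.
Qed.

Lemma rtilde_C2 i j : rtilde (C2 n) i j = C2_d i j.
Proof. exact: addnK. Qed.

Lemma mem_C2_block_range i j l :
  (l \in block_range (C2 n) i j) = (eps i j <= l <= C2_d i j + eps i j)%N.
Proof. by rewrite mem_filter mem_iota /= add0n ltnS. Qed.

(** Within the range of l the truncated subtraction in the definition of the
    relation is exact, so the equation can be put in additive form. *)
Lemma mem_C2_rel i j l x y :
  l \in block_range (C2 n) i j ->
  ((x, y) \in C2_rel i j l) =
    [&& weight x == i, weight y == j &
        (overlap x y + l == minn i j + eps i j)%N].
Proof.
rewrite mem_C2_block_range => hl; rewrite !inE /= -/(weight x) -/(weight y).
rewrite -/(overlap x y) -andbA; case: eqP => //= ex; case: eqP => //= ey.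
have := overlap_leql x y; have := overlap_leqr x y; rewrite ex ey.
have := overlap_geq x y; rewrite ex ey.
move: hl; rewrite /C2_d; move: (eps i j) => e.
lia.
Qed.

(** The index of the relation that contains (x, y), in the block of its
    fibers. *)
Definition block_index x y : nat :=
  (minn (weight x) (weight y) + eps (fiber_index x) (fiber_index y)
    - overlap x y)%N.

Lemma block_index_range x y :
  block_index x y \in block_range (C2 n) (fiber_index x) (fiber_index y).
Proof.
rewrite mem_C2_block_range /block_index /C2_d /=.
have := overlap_leql x y; have := overlap_leqr x y; have := overlap_geq x y.
by move: (eps _ _) => e; lia.
Qed.

Lemma C2_rel_orbital i j l p :
  l \in block_range (C2 n) i j -> p \in C2_rel i j l ->
  C2_rel i j l = orbital p.
Proof.
case: p => x y hl; rewrite mem_C2_rel // => /and3P[/eqP ex /eqP ey /eqP exy].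
apply/setP => -[x' y']; rewrite mem_C2_rel // !inE /pair_type !xpair_eqE /= ex
  ey.
rewrite -andbA; congr [&& _, _ & _]; rewrite -exy; lia.
Qed.

Lemma mem_block_index x y :
  (x, y) \in C2_rel (fiber_index x) (fiber_index y) (block_index x y).
Proof.
rewrite mem_C2_rel ?block_index_range // !eqxx /= /block_index.
have := overlap_leql x y; have := overlap_leqr x y.
by move: (eps _ _) => e; lia.
Qed.

Lemma C2_rel_nonempty i j l : l \in block_range (C2 n) i j ->
  exists p, p \in C2_rel i j l.
Proof.
move=> hl; have := hl; rewrite mem_C2_block_range /C2_d.
have [] := (ltn_ord i, ltn_ord j) => hi hj hl'.
have [||| x [y [ex ey exy]]] :=
  @exists_pair n i j (minn i j + eps i j - l) => //; try lia.
by exists (x, y); rewrite mem_C2_rel // ex ey exy !eqxx /=; lia.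
Qed.

Lemma relationsP (S : {set n.-tuple bool * n.-tuple bool}) :
  reflect (exists p, S = orbital p) (S \in relations (C2 n)).
Proof.
rewrite inE; apply: (iffP existsP) => [[i /existsP[j /hasP[l hl /eqP ->]]]|].
  by have [p hp] := C2_rel_nonempty hl; exists p; apply: C2_rel_orbital.
case=> -[x y] ->; exists (fiber_index x); apply/existsP; exists (fiber_index y).
apply/hasP; exists (block_index x y); first exact: block_index_range.
by apply/eqP/esym/C2_rel_orbital;
  [exact: block_index_range|exact: mem_block_index].
Qed.

Lemma relations_preim : relations (C2 n) = preim_partition pair_type setT.
Proof.
apply/setP => S; apply/relationsP/imsetP => [[p ->]|[p _ ->]]; exists p => //;
  by apply/setP => q; rewrite !inE eq_sym.
Qed.

(** An intersection number counts the z standing in given relations to x and y;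
    a permutation of the coordinates carrying (x, y) to (x', y') maps the
    words counted for one pair to those counted for the other. *)
Lemma C2_coherent : coherent_configuration (relations (C2 n)).
Proof.
split.
- by apply/card_gt0P; exists (segment n 0 0).
- by rewrite relations_preim preim_partitionP.
- move=> _ /relationsP[p ->] /set0Pn[[x x'] /setIP[]]; rewrite !inE /=.
  rewrite /orbital => /eqP <- /eqP <-; apply/subsetP => -[y z];
    rewrite !inE /pair_type /=.
  rewrite overlapxx !xpair_eqE => /andP[/andP[/eqP ey /eqP ez] /eqP eyz].
  by apply/eqP/overlap_eq; rewrite ?ey ?ez.
- move=> _ /relationsP[[x y] ->]; apply/relationsP; exists (y, x).
  apply/setP => -[y' x']; rewrite !inE /pair_type /= !xpair_eqE.
  by rewrite (overlapC x') (overlapC x) [(weight x' == _) && _]andbC.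
move=> _ _ _ /relationsP[p ->] /relationsP[q ->] /relationsP[r ->].
move=> [x y] [x' y']; rewrite !inE => /eqP exy /eqP exy'.
have [ex ey eo] : [/\ weight x = weight x', weight y = weight y' &
    overlap x y = overlap x' y'] by move: exy; rewrite -exy' => -[].
have [s [<- <-]] := permute_transitive ex ey eo.
rewrite /intersection_number -(card_imset _ (can_inj (permuteKV s))).
apply: eq_card => z; rewrite -[z](permuteVK s) (mem_imset _ _ (can_inj
  (permuteKV s))).
by rewrite !inE /pair_type /= !weight_permute !overlap_permute.
Qed.

Lemma C2_fiber_nonempty i : exists x, weight x = i.
Proof.
by exists (segment n 0 i); rewrite weight_segment ?subn0 // -ltnS ltn_ord.
Qed.

Lemma C2_rel0 i : C2_rel i i 0 = diagonal (C2_fiber i).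
Proof.
apply/setP => -[x y]; rewrite mem_C2_rel; last first.
  by rewrite mem_C2_block_range /eps eqxx.
rewrite !inE /eps eqxx /= !addn0 minnn -/(weight x).
apply/and3P/andP => [[/eqP ex /eqP ey /eqP exy]|[/eqP ex /eqP <-]].
  by rewrite ex eqxx; split=> //; apply/eqP/overlap_eq; rewrite ?exy ?ex ?ey.
by rewrite overlapxx ex eqxx.
Qed.

Lemma eps_sym i j : eps i j = eps j i.
Proof. by rewrite /eps eq_sym. Qed.

Lemma C2_d_sym i j : C2_d i j = C2_d j i.
Proof. by rewrite /C2_d; lia. Qed.

Lemma block_range_sym i j : block_range (C2 n) i j = block_range (C2 n) j i.
Proof. by rewrite !C2_block_range eps_sym C2_d_sym. Qed.

Lemma C2_well_numbered : well_numbered (C2 n).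
Proof.
split.
- split=> [i j /= eij|].
    have [x ex] := C2_fiber_nonempty i; apply/val_inj => /=.
    have : x \in C2_fiber i by rewrite mem_fiber ex.
    by rewrite eij mem_fiber ex => /eqP.
  apply/setP => F; rewrite inE;
    apply/relationsP/imsetP => [[[x y] eF]|[i _ ->]].
    have : (x, y) \in diagonal F by rewrite eF inE.
    rewrite inE /= => /andP[xF /eqP exy]; rewrite -{y}exy in eF.
    exists (fiber_index x) => //; apply/setP => z; rewrite mem_fiber /=.
    have <- : ((z, z) \in diagonal F) = (z \in F) by rewrite inE /= eqxx andbT.
    by rewrite eF inE /pair_type /= !overlapxx !xpair_eqE !andbb.
  have [x ex] := C2_fiber_nonempty i; exists (x, x) => /=.
  rewrite -C2_rel0; apply: C2_rel_orbital.
    by rewrite mem_C2_block_range /eps eqxx.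
  by rewrite C2_rel0 !inE /= -/(weight x) ex !eqxx.
- by move=> i j /=; rewrite C2_d_sym eps_sym.
- by move=> i j l _ /=; apply/subsetP => p; rewrite inE => /andP[].
- move=> i j l l' hl hl' /= e; have [[x y] hp] := C2_rel_nonempty hl.
  have := hp; rewrite e; move: hp; rewrite !mem_C2_rel //.
  by case/and3P=> _ _ /eqP e1 /and3P[_ _ /eqP e2]; lia.
- split=> [i|i j l hl] /=; first exact: C2_rel0.
  apply/setP => -[x y]; rewrite [RHS]inE /= !mem_C2_rel //; last first.
    by rewrite block_range_sym.
  by rewrite overlapC minnC eps_sym; case: eqP => //=; case: eqP.
Qed.

(** Overlap is symmetric, so exchanging x and y preserves the type of a pair of
    words of equal weight. *)
Lemma C2_symmetric_fibers : symmetric_fibers (relations (C2 n)).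
Proof.
have [[_ efib] _ _ _ _] := C2_well_numbered.
move=> F S; rewrite efib => /imsetP[i _ ->{F}] /relationsP[p eS] /subsetP sS.
have w_eq q : q \in S -> weight q.1 = weight q.2.
  by move/sS; rewrite !inE -!/(weight _) => /andP[/eqP -> /eqP ->].
have wp : weight p.1 = weight p.2 by apply: w_eq; rewrite eS inE.
rewrite eS; apply/setP => -[x y]; rewrite !inE /pair_type /= !xpair_eqE wp.
by rewrite [overlap y x]overlapC [(weight y == _) && _]andbC.
Qed.

End Config.

(** * Matrices invariant under permutations of the coordinates *)

Section InvariantMatrices.
Variables (n : nat) (C : numClosedFieldType).
Implicit Types (x y z : n.-tuple bool) (m k : 'I_n) (i j : 'I_n.+1).
Local Notation mx := 'M[C]_(#|{: n.-tuple bool}|).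
Implicit Types (M N : mx).

(** Entries indexed by words instead of their ranks in the enumeration. *)
Definition entry M x y : C := M (enum_rank x) (enum_rank y).

Lemma entryP M N : entry M =2 entry N -> M = N.
Proof.
move=> e; apply/matrixP => a b; have := e (enum_val a) (enum_val b).
by rewrite /entry !enum_valK.
Qed.

Lemma entry_mul M N x y : entry (M *m N) x y = \sum_z entry M x z * entry N z y.
Proof.
rewrite /entry mxE (reindex (@enum_rank _)) //=.
exact/onW_bij/enum_rank_bij.
Qed.

Lemma entry_tr M x y : entry M^T x y = entry M y x.
Proof. exact: mxE. Qed.

Lemma entryZ (c : C) M x y : entry (c *: M) x y = c * entry M x y.
Proof. exact: mxE. Qed.

Lemma entry_adjacency (S : {set n.-tuple bool * n.-tuple bool}) x y :
  entry (adjacency C S) x y = ((x, y) \in S)%:R.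
Proof. by rewrite /entry mxE !enum_rankK. Qed.

Definition perm_invariant M :=
  forall (s : 'S_n) x y, entry M (permute s x) (permute s y) = entry M x y.

Lemma invariant_pair_type M x y x' y' : perm_invariant M ->
  weight x = weight x' -> weight y = weight y' -> overlap x y = overlap x' y' ->
  entry M x y = entry M x' y'.
Proof.
by move=> iM ex ey eo; have [s [<- <-]] := permute_transitive ex ey eo;
  rewrite iM.
Qed.

Lemma invariant_of_type M (f : nat -> nat -> nat -> C) :
    (forall x y, entry M x y = f (weight x) (weight y) (overlap x y)) ->
  perm_invariant M.
Proof. by move=> eM s x y; rewrite !eM !weight_permute overlap_permute. Qed.

Lemma invariant_mul M N :
  perm_invariant M -> perm_invariant N -> perm_invariant (M *m N).
Proof.
move=> iM iN s x y; rewrite !entry_mul (reindex (permute s)) /=; last first.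
  by exists (permute s^-1%g) => z _; [exact: permuteKV|exact: permuteVK].
by apply: eq_bigr => z _; rewrite iM iN.
Qed.

Lemma invariant_tr M : perm_invariant M -> perm_invariant M^T.
Proof. by move=> iM s x y; rewrite !entry_tr iM. Qed.

Lemma invariantZ (c : C) M : perm_invariant M -> perm_invariant (c *: M).
Proof. by move=> iM s x y; rewrite !entryZ iM. Qed.

Definition supported M (a b : nat) :=
  forall x y, entry M x y != 0 -> weight x = a /\ weight y = b.

Lemma supported_tr M a b : supported M a b -> supported M^T b a.
Proof. by move=> sM x y; rewrite entry_tr => /sM []. Qed.

Lemma supportedZ (c : C) M a b : supported M a b -> supported (c *: M) a b.
Proof.
by move=> sM x y; rewrite entryZ mulf_eq0 => /norP[_ /sM].
Qed.

Lemma entry_mul_neq0 M N x y : entry (M *m N) x y != 0 ->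
  exists2 z, entry M x z != 0 & entry N z y != 0.
Proof.
rewrite entry_mul => h.
have [z hz|e] := pickP (fun z => entry M x z * entry N z y != 0).
  by exists z; apply: contraNneq hz => ->; rewrite ?mul0r ?mulr0.
by case/eqP: h; apply: big1 => z _; apply/eqP; rewrite -[_ == _]negbK e.
Qed.

Lemma supported_mul M N a b b' d :
  supported M a b -> supported N b' d -> supported (M *m N) a d.
Proof. by move=> sM sN x y /entry_mul_neq0[z /sM[-> _] /sN[_ ->]]. Qed.

Lemma supported_mul0 M N a b b' d :
  supported M a b -> supported N b' d -> b <> b' -> M *m N = 0.
Proof.
move=> sM sN nb; apply/entryP => x y; rewrite {2}/entry mxE; apply/eqP.
apply/negbNE/negP => /entry_mul_neq0[z /sM[_ ez] /sN[ez' _]].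
by apply: nb; rewrite -ez.
Qed.

Local Notation A := (A_ (C2 n) C).

Lemma entry_A i j l x y : entry (A i j l) x y = ((x, y) \in C2_rel i j l)%:R.
Proof. exact: entry_adjacency. Qed.

Lemma supported_A i j l : supported (A i j l) i j.
Proof.
move=> x y; rewrite entry_A; case: (boolP (_ \in _)) => [|_];
  last by rewrite eqxx.
by rewrite !inE /= -!/(weight _) => /andP[/andP[/eqP-> /eqP->]].
Qed.

Lemma invariant_A i j l : perm_invariant (A i j l).
Proof.
apply: (@invariant_of_type _ (fun a b o =>
  [&& a == i, b == j & (l == minn i j + eps i j - o)%N]%:R)) => x y.
by rewrite entry_A !inE /= -!/(weight _) -/(overlap x y) andbA.
Qed.

(** An invariant matrix is constant on each relation.  The second part recovers
    the coefficients from the entries at arbitrary representatives. *)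
Lemma block_expansion M i j : supported M i j -> perm_invariant M ->
  exists c : nat -> C,
    M = \sum_(l <- block_range (C2 n) i j) c l *: A i j l /\
    forall l, l \in block_range (C2 n) i j ->
      forall x y, (x, y) \in C2_rel i j l -> c l = entry M x y.
Proof.
move=> sM iM.
pose c l := if [pick p | p \in C2_rel i j l] is Some p
  then entry M p.1 p.2 else 0.
have cE l : l \in block_range (C2 n) i j ->
      forall x y, (x, y) \in C2_rel i j l -> c l = entry M x y.
  move=> hl x y hxy; rewrite /c.
  case: pickP => [[x' y']|/(_ (x, y))]; last first.
    by rewrite hxy.
  move: hxy; rewrite !mem_C2_rel // => /and3P[/eqP ex /eqP ey /eqP eo].
  case/and3P=> /eqP ex' /eqP ey' /eqP eo'.
  by apply: invariant_pair_type => //=; rewrite ?ex ?ey //; lia.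
exists c; split=> //; apply/entryP => x y.
have entry_sum r : entry (\sum_(l <- r) c l *: A i j l) x y =
    \sum_(l <- r) c l * ((x, y) \in C2_rel i j l)%:R.
  elim: r => [|l r IH]; first by rewrite !big_nil /entry mxE.
  by rewrite !big_cons -IH -entry_A -entryZ /entry mxE.
rewrite entry_sum.
have [/andP[/eqP wx /eqP wy]|nw] := boolP ((weight x == i) && (weight y == j)).
  have ei : fiber_index x = i by apply/val_inj.
  have ej : fiber_index y = j by apply/val_inj.
  have hl := block_index_range x y; have hxy := mem_block_index x y.
  rewrite ei ej in hl hxy.
  rewrite (bigD1_seq (block_index x y)) ?filter_uniq ?iota_uniq //=.
  rewrite hxy mulr1 -(cE _ hl x y hxy) big1_seq ?addr0 // => l /andP[nl hl'].
  case: (boolP (_ \in _)) => [hxy'|_]; last by rewrite mulr0.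
  case/eqP: nl; move: hxy hxy'; rewrite !mem_C2_rel //.
  by case/and3P=> _ _ /eqP e1 /and3P[_ _ /eqP e2]; lia.
have -> : entry M x y = 0.
  by apply/eqP/(contraNT _ nw) => /sM[-> ->]; rewrite !eqxx.
rewrite big1_seq // => l _; case: (boolP (_ \in _)) => [|_];
  last by rewrite mulr0.
rewrite !inE /= -!/(weight _) => /andP[/andP[ex ey]].
by rewrite ex ey in nw.
Qed.

Lemma A_in_space i j l : l \in block_range (C2 n) i j ->
  A i j l \in A_space (C2 n) C i j.
Proof. by move=> hl; apply/memv_span/mapP; exists l. Qed.

Lemma mem_A_space M i j : supported M i j -> perm_invariant M ->
  M \in A_space (C2 n) C i j.
Proof.
move=> sM iM; have [c [-> _]] := block_expansion sM iM.
rewrite big_seq; apply: memv_suml => l hl; apply/memvZ/A_in_space/hl.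
Qed.

End InvariantMatrices.

(** * Polynomials expressing the eigenvalues of a block *)

Section PPoly.
Variables (n : nat) (C : numClosedFieldType).
Implicit Types (x y z : n.-tuple bool) (i j : 'I_n.+1).
Local Notation mx := 'M[C]_(#|{: n.-tuple bool}|).
Local Notation A := (A_ (C2 n) C).

(** Exchange a one of x outside y for a one of y outside x. *)
Lemma exists_swap x y : (overlap x y < minn (weight x) (weight y))%N ->
  exists z, [/\ weight z = weight x, (overlap x z).+1 = weight x &
                overlap z y = (overlap x y).+1].
Proof.
rewrite leq_min => /andP[ox oy].
have [a]: exists a, a \in supp x :\: supp y.
  apply/card_gt0P; have := cardsID (supp y) (supp x).
  by move: ox; rewrite /overlap /weight; lia.
rewrite !inE => /andP[ya xa].
have [b]: exists b, b \in supp y :\: supp x.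
  apply/card_gt0P; have := cardsID (supp x) (supp y).
  by move: oy; rewrite overlapC /overlap /weight; lia.
rewrite !inE => /andP[xb yb].
have xb' : ~~ tnth (flip x a) b.
  by rewrite tnth_flip (negPf xb); case: eqP xb xa => // -> /negPf ->.
have wx := weight_flip0 xa.
exists (flip (flip x a) b); split.
- by rewrite weight_flip1.
- rewrite overlapC overlap_flip1 // (negPf xb) addn0.
  have := overlap_flip0 (flip x a) xa.
  rewrite tnth_flip eqxx xa addn0 overlapxx => e.
  by rewrite overlapC e.
- by rewrite overlap_flip1 // yb addn1 (overlap_flip0 y xa) (negPf ya) addn0.
Qed.

Lemma overlap_triangle x y z :
  (overlap x z + overlap z y <= overlap x y + weight z)%N.
Proof.
rewrite /overlap /weight -cardsUI addnC leq_add //; apply: subset_leq_card.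
  by apply/subsetP => m; rewrite !inE => /andP[/andP[-> _] /andP[_ ->]].
by apply/subsetP => m; rewrite !inE => /orP[/andP[]|/andP[]].
Qed.

(** The entry at (x, y) of the product counts the z at exchange distance one
    from x with (z, y) in R_l.  By [overlap_triangle] there is none when (x, y)
    lies in R_l' with l' > l + 1, and [exists_swap] provides one for R_{l+1}. *)
Lemma mul_A1 i j l :
    l \in block_range (C2 n) i j -> l.+1 \in block_range (C2 n) i j ->
  exists c : nat -> C, [/\ c l.+1 != 0,
    forall l', l' \in block_range (C2 n) i j -> (l.+1 < l')%N -> c l' = 0
    & A i i 1 *m A i j l =
      \sum_(l' <- block_range (C2 n) i j) c l' *: A i j l'].
Proof.
move=> hl hl1.
have sM := supported_mul (@supported_A n C i i 1) (@supported_A n C i j l).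
have iM := invariant_mul (@invariant_A n C i i 1) (@invariant_A n C i j l).
have [c [eM cE]] := block_expansion sM iM.
have A1E x z : entry (A i i 1) x z != 0 ->
    [/\ weight x = i, weight z = i & (overlap x z).+1 = i].
  rewrite entry_A !inE /= -!/(weight _) -/(overlap x z) /eps eqxx minnn addn0.
  rewrite pnatr_eq0 eqb0 negbK => /andP[/andP[/eqP ex /eqP ez] /eqP e].
  by split=> //; lia.
exists c; split=> //.
- have [[x y] hxy] := C2_rel_nonempty hl1; rewrite (cE _ hl1 _ _ hxy).
  move: hxy; rewrite mem_C2_rel // => /and3P[/eqP ex /eqP ey /eqP eo].
  have [|z [ez exz ezy]] := @exists_swap x y.
    by rewrite ex ey; move: hl; rewrite mem_C2_block_range; lia.
  rewrite entry_mul (bigD1 z) //= gt_eqF // ltr_pwDl //.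
    rewrite !entry_A [(z, y) \in _]mem_C2_rel // ez ex ey !eqxx /=.
    rewrite !inE /= -!/(weight _) -/(overlap x z) ez ex eqxx minnn [eps i
      i]/eps eqxx /=.
    have -> : 1%N == (i + 0 - overlap x z)%N by lia.
    have -> : (overlap z y + l == minn i j + eps i j)%N by lia.
    by rewrite mulr1.
  by apply: sumr_ge0 => t _; rewrite !entry_A mulr_ge0.
- move=> l' hl' ll'; have [[x y] hxy] := C2_rel_nonempty hl'.
  rewrite (cE _ hl' _ _ hxy); apply/eqP/negbNE/negP => /entry_mul_neq0[z].
  move=> /A1E[ex ez exz]; rewrite entry_A.
  case: (boolP (_ \in _)) => [|_ /eqP //]; move: hxy; rewrite !mem_C2_rel //.
  move=> /and3P[_ _ /eqP eo] /and3P[_ _ /eqP eo'] _.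
  by have := overlap_triangle x y z; lia.
Qed.

Variable E : 'I_n.+1 -> 'I_n.+1 -> nat -> mx.
Hypothesis eigE : eigen_matrices (C2 n) E.
Local Notation P i j := (fun l h => @P_eigenvalue _ _ (C2 n) C E i j l h).

Lemma rtilde_diag i j : (rtilde (C2 n) i j <= rtilde (C2 n) i i)%N.
Proof. by rewrite !rtilde_C2 /C2_d; lia. Qed.

Lemma E_tuple_nth i j (h : 'I_(rtilde (C2 n) i j).+1) :
  (E_tuple (C2 n) E i j)`_h = E i j h.
Proof. by rewrite -tnth_nth tnth_mktuple. Qed.

(** By (B4) the coordinates of a product multiply, componentwise in h.  The
    components of the block (i, j) form an initial segment of those of (i, i),
    which explains the inord. *)
Lemma coord_mul i j M N (h : 'I_(rtilde (C2 n) i j).+1) :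
    M \in A_space (C2 n) C i i -> N \in A_space (C2 n) C i j ->
  coord (E_tuple (C2 n) E i j) h (M *m N) =
  coord (E_tuple (C2 n) E i i) (inord h) M * coord (E_tuple (C2 n) E i j) h N.
Proof.
have [_ basE _ [_ mulE]] := eigE => hM hN.
have /(coord_basis (basE i i)) eM := hM;
  have /(coord_basis (basE i j)) eN := hN.
pose w := widen_ord (rtilde_diag i j : (_.+1 <= _.+1)%N).
rewrite {1}eM {1}eN mulmx_sumr.
rewrite (eq_bigr (fun k => (coord (E_tuple (C2 n) E i i) (w k) M *
    coord (E_tuple (C2 n) E i j) k N) *: (E_tuple (C2 n) E i j)`_k));
      last first.
  move=> k _; rewrite mulmx_suml (bigD1 (w k)) // big1 ?addr0.
    rewrite -scalemxAr -scalemxAl scalerA !E_tuple_nth mulE ?[w k : nat]/=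
      ?eqxx ?scale1r //.
      by rewrite /= addr0 mulrC.
    by have := ltn_ord k; have := rtilde_diag i j; lia.
    exact: leq_ord.
  move=> k' nk; rewrite -scalemxAr -scalemxAl !E_tuple_nth mulE ?leq_ord //.
  by rewrite eqxx /= (_ : _ == _ = false) ?scale0r ?scaler0 //; apply/negbTE.
rewrite coord_sum_free ?(basis_free (basE i j)) //; congr (coord _ _ _ * _).
by apply/val_inj; rewrite /= inordK // (leq_trans (ltn_ord h)) // ltnS
  rtilde_diag.
Qed.

(** The eigenvalue of A_1^(i,i) on E_h.  When the fiber has a single point
    index 1 is out of range; A_1^(i,i) is then the zero matrix, which still
    lies in the block. *)
Definition theta i (h : nat) : C :=
  coord (E_tuple (C2 n) E i i) (inord h) (A i i 1).

Lemma P_recursion i j k : (k < C2_d i j)%N ->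
  exists c : nat -> C, c k.+1 != 0 /\ forall h : 'I_(rtilde (C2 n) i j).+1,
    theta i h * P i j (eps i j + k)%N h =
      \sum_(k' < k.+2) c k' * P i j (eps i j + k')%N h.
Proof.
move=> hk.
have [||c [c1 c0 eM]] := @mul_A1 i j (eps i j + k)%N.
- by rewrite mem_C2_block_range; lia.
- by rewrite mem_C2_block_range; lia.
exists (fun k' => c (eps i j + k')%N); split=> [|h]; first by rewrite addnS.
rewrite /theta -coord_mul.
- rewrite eM linear_sum /= C2_block_range -{1}[eps i j]addn0 iotaDl big_map.
  rewrite -(big_mkord xpredT (fun k' =>
    c (eps i j + k')%N * P i j (eps i j + k')%N h)).
  rewrite (@big_cat_nat _ _ _ k.+2 0 (C2_d i j).+1) //= [X in _ + X]big_nat.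
  rewrite [X in _ + X]big1 ?addr0 => [|k' hk'].
    by apply: eq_bigr => k' _; rewrite linearZ.
  rewrite c0 ?scale0r ?linear0 ?mem_C2_block_range //; lia.
- exact/mem_A_space/invariant_A/supported_A.
- exact/mem_A_space/invariant_A/supported_A.
Qed.

(** Solving [P_recursion] for its last term, whose coefficient is not zero,
    multiplies the previous polynomial by theta up to lower terms. *)
Lemma P_polynomial_theta i j :
  exists u : nat -> {poly C}, u 0%N = 1 /\
    forall k, (k <= C2_d i j)%N -> size (u k) = k.+1 /\
      forall h, P i j (eps i j + k)%N h = (u k).[theta i h] * P i j (eps i j) h.
Proof.
suff H K : (K <= C2_d i j)%N -> exists u : nat -> {poly C}, u 0%N = 1 /\
    forall k, (k <= K)%N -> size (u k) = k.+1 /\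
      forall h, P i j (eps i j + k)%N h = (u k).[theta i h] * P i j (eps i j) h.
  exact: H.
elim: K => [_|K IH hK].
  exists (fun=> 1); split=> // k; rewrite leqn0 => /eqP ->.
  by rewrite size_poly1 addn0; split=> // h; rewrite hornerE mul1r.
have [u [u0 hu]] := IH (ltnW hK); have [c [c1 ec]] := P_recursion hK.
pose q : {poly C} := (c K.+1)^-1 *: ('X * u K - \sum_(k' < K.+1) c k' *: u k').
exists (fun k => if k == K.+1 then q else u k); split=> // k.
rewrite leq_eqVlt ltnS; case: eqP => [-> _|_ /hu //]; split.
  rewrite size_scale ?invr_eq0 // mulrC size_polyDl size_mulX -?size_poly_gt0
    ?(hu K _).1 //.
  rewrite size_polyN; apply: (leq_ltn_trans (size_sum _ _ _)).
  rewrite ltnS; apply/bigmax_leqP => k' _;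
    apply: (leq_trans (size_scale_leq _ _)).
  by rewrite (hu k' _).1 ?leq_ord.
move=> h; apply: (mulfI c1); have := ec h; rewrite big_ord_recr /=.
move/eqP; rewrite addrC -subr_eq => /eqP <-.
rewrite /q !hornerE /= divff // mul1r mulrBl -mulrA -(hu K _).2 //.
congr (_ - _); rewrite horner_sum mulr_suml; apply: eq_bigr => k' _.
by rewrite (hu k' _).2 ?leq_ord // hornerZ mulrA.
Qed.

(** If P_eps(h) vanished, so would P_l(h) for all l by [P_polynomial_theta], and
    the coordinate along E_h would be zero on the whole block, E_h included. *)
Lemma P_eps_neq0 i j (h : 'I_(rtilde (C2 n) i j).+1) : P i j (eps i j) h != 0.
Proof.
have [_ basE _ _] := eigE; have [u [_ hu]] := P_polynomial_theta i j.
apply/eqP => P0.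
have : E i j h \in A_space (C2 n) C i j.
  by rewrite -(span_basis (basE i j)) -E_tuple_nth memv_span ?mem_nth
    ?size_tuple.
move/(coord_span (X := in_tuple [seq A i j l | l <- block_range (C2 n) i j])).
move/(congr1 (coord (E_tuple (C2 n) E i j) h));
  rewrite -{1}E_tuple_nth coord_free ?(basis_free (basE i j)) //.
rewrite eqxx linear_sum big1 => [/eqP|k _]; first by rewrite oner_eq0.
rewrite linearZ; set X := _`_k.
apply: etrans (mulr0 _); congr (_ * _).
change (coord (E_tuple (C2 n) E i j) h X = 0).
have /mapP[l hl ->] : X \in [seq A i j l | l <- block_range (C2 n) i j].
  exact/mem_nth/ltn_ord.
have [k' -> hk'] : exists2 k', l = (eps i j + k')%N & (k' <= C2_d i j)%N.
  by exists (l - eps i j)%N; move: hl; rewrite mem_C2_block_range; lia.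
by apply: (etrans ((hu k' hk').2 h)); rewrite P0 mulr0.
Qed.

Lemma C2_P_polynomial_block i j : P_polynomial_block (C2 n) E i j.
Proof.
exists id; split=> //; first by rewrite map_id.
  exact: P_eps_neq0.
have [u [u0 hu]] := P_polynomial_theta i j.
pose a := (u 1%N)`_1; pose b := (u 1%N)`_0.
have a_neq0 : (1 <= C2_d i j)%N -> a != 0.
  move=> h1; have [s1 _] := hu 1%N h1.
  have : lead_coef (u 1%N) != 0 by rewrite lead_coef_eq0 -size_poly_gt0 s1.
  by rewrite lead_coefE s1.
(* For l = eps the polynomial is the constant 1.  Otherwise the block has at
   least two relations, u_1 = a X + b has degree one, and composing with its
   inverse turns polynomials in theta into polynomials in u_1(theta). *)
exists (fun l => u (l - eps i j)%N \Po
  (if l == eps i j then 'X else a^-1 *: ('X - b%:P))) => l hl.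
have [k el hk] : exists2 k', l = (eps i j + k')%N & (k' <= C2_d i j)%N.
  by exists (l - eps i j)%N; move: hl; rewrite mem_C2_block_range; lia.
rewrite {}el in hl *; rewrite addKn.
have [sk ek] := hu k hk; split.
  rewrite size_comp_poly2 //; case: eqP => [|nk]; first by rewrite size_polyX.
  have h1 : (1 <= C2_d i j)%N by lia.
  by rewrite size_scale ?size_XsubC // invr_eq0 a_neq0.
move=> h; rewrite /= ek mulfK ?P_eps_neq0 // horner_comp.
case: eqP => [ke|nk].
  have -> : k = 0%N by lia.
  by rewrite u0 !hornerE.
have h1 : (1 <= C2_d i j)%N by lia.
have [s1 e1] := hu 1%N h1.
rewrite -[(eps i j).+1]addn1 e1 mulfK ?P_eps_neq0 //; congr horner.
have -> : (u 1%N).[theta i h] = a * theta i h + b.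
  by rewrite horner_coef s1 !big_ord_recl big_ord0 /= expr0 expr1 mulr1 addr0
    addrC.
by rewrite !hornerE addrK mulKf // a_neq0.
Qed.

End PPoly.

(** * The cover relation of the Boolean lattice *)

Section Cover.
Variables (n : nat) (C : numClosedFieldType).
Implicit Types (x y z : n.-tuple bool) (m k : 'I_n) (i j : 'I_n.+1).
Local Notation mx := 'M[C]_(#|{: n.-tuple bool}|).
Implicit Types (M N : mx).

Definition cover_rel : {set n.-tuple bool * n.-tuple bool} :=
  [set p | (weight p.2 == (weight p.1).+1) && (overlap p.1 p.2 == weight p.1)].

Definition cover_mx : mx := adjacency C cover_rel.

Lemma flip_inj x : injective (flip x).
Proof.
move=> m k /(congr1 ((@tnth _ _)^~ m)); rewrite !tnth_flip eqxx.
by move/addIb/esym/eqP.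
Qed.

Lemma cover_relP x z :
  reflect (exists2 m, ~~ tnth x m & z = flip x m) ((x, z) \in cover_rel).
Proof.
rewrite inE /= overlap_subset; apply: (iffP andP) => [[/eqP wz sxz]|[m xm ->]].
  have : #|supp z :\: supp x| == 1%N.
    by rewrite cardsD setIC (setIidPl sxz); move: wz; rewrite /weight => ->;
      lia.
  case/cards1P => m em; have : m \in supp z :\: supp x by rewrite em set11.
  rewrite !inE => /andP[xm zm]; exists m => //; apply/supp_inj.
  rewrite supp_flip1 // -em; apply/setP => k; rewrite !inE.
  by have := subsetP sxz k; rewrite !inE; case: (tnth x k) => [->|] //=;
    rewrite orbF.
by rewrite weight_flip1 // supp_flip1 // subsetUr.
Qed.

Lemma entry_cover_mul M x y :
  entry (cover_mx *m M) x y = \sum_(m | ~~ tnth x m) entry M (flip x m) y.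
Proof.
rewrite entry_mul.
transitivity
  (\sum_(z in [set flip x m | m in [set m | ~~ tnth x m]]) entry M z y).
  rewrite [RHS]big_mkcond /=; apply: eq_bigr => z _; rewrite entry_adjacency.
  have -> : (z \in [set flip x m | m in [set m | ~~ tnth x m]]) =
      ((x, z) \in cover_rel).
    apply/imsetP/cover_relP => [[m]|[m xm ->]]; first by rewrite inE => ? ->;
      exists m.
    by exists m; rewrite ?inE.
  by case: (_ \in _); rewrite ?mul1r ?mul0r.
rewrite big_imset /=; last by move=> ? ? _ _; apply: flip_inj.
by apply: eq_bigl => m; rewrite inE.
Qed.

Lemma entry_coverT_mul M x y :
  entry (cover_mx^T *m M) x y = \sum_(m | tnth x m) entry M (flip x m) y.
Proof.
rewrite entry_mul.
transitivity (\sum_(z in [set flip x m | m in supp x]) entry M z y).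
  rewrite [RHS]big_mkcond /=; apply: eq_bigr => z _.
  rewrite entry_tr entry_adjacency.
  have -> : (z \in [set flip x m | m in supp x]) = ((z, x) \in cover_rel).
    apply/imsetP/cover_relP => [[m]|[m zm ->]].
      by rewrite inE => xm ->; exists m; rewrite ?flipK // tnth_flip eqxx xm.
    by exists m; rewrite ?flipK // inE tnth_flip eqxx (negPf zm).
  by case: (_ \in _); rewrite ?mul1r ?mul0r.
rewrite big_imset /=; last by move=> ? ? _ _; apply: flip_inj.
by apply: eq_bigl => m; rewrite inE.
Qed.

Lemma card_off_supp x : #|[pred m | ~~ tnth x m]| = (n - weight x)%N.
Proof.
have := cardsC (supp x); rewrite card_ord.
have -> : #|[pred m | ~~ tnth x m]| = #|~: supp x|.
  by apply: eq_card => m; rewrite !inE.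
by rewrite /weight; lia.
Qed.

Lemma card_on_supp x : #|[pred m | tnth x m]| = weight x.
Proof. by apply: eq_card => m; rewrite !inE. Qed.

(** Going up by m and then down by k, or conversely, gives the same word when
    m <> k.  The case m = k returns to x, in n - w(x) ways when going up first
    and in w(x) ways when going down first. *)
Lemma cover_commutator M b d : supported M b d ->
  cover_mx *m (cover_mx^T *m M) =
  cover_mx^T *m (cover_mx *m M) + (n%:R - (b.*2)%:R) *: M.
Proof.
move=> sM; apply/entryP => x y.
have -> : entry (cover_mx^T *m (cover_mx *m M) + (n%:R - b.*2%:R) *: M) x y =
    entry (cover_mx^T *m (cover_mx *m M)) x y +
    (n%:R - (weight x).*2%:R) * entry M x y.
  rewrite {1}/entry mxE; congr (_ + _); rewrite -/(entry _ x y) entryZ.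
  by have [->|/sM[-> _]] := eqVneq (entry M x y) 0; rewrite ?mulr0.
pose g z := entry M z y; rewrite entry_cover_mul entry_coverT_mul.
transitivity (\sum_(m | ~~ tnth x m)
    (g x + \sum_(k | tnth x k) g (flip (flip x m) k))).
  apply: eq_bigr => m xm; rewrite entry_coverT_mul (bigD1 m) /=; last first.
    by rewrite tnth_flip eqxx.
  rewrite flipK; congr (_ + _); apply: eq_bigl => k; rewrite tnth_flip.
  by case: eqP => [->|_] /=; rewrite ?andbF ?andbT // (negPf xm).
have -> : \sum_(m | tnth x m) entry (cover_mx *m M) (flip x m) y =
    \sum_(k | tnth x k) (g x + \sum_(m | ~~ tnth x m) g (flip (flip x m) k)).
  apply: eq_bigr => m xm; rewrite entry_cover_mul (bigD1 m) /=; last first.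
    by rewrite tnth_flip eqxx xm.
  rewrite flipK; congr (_ + _); apply: eq_big => k; last by rewrite flipC.
  by rewrite tnth_flip; case: eqP => [->|_] /=; rewrite ?andbF ?andbT // xm.
rewrite !big_split /= [X in _ + X]exchange_big /= !sumr_const card_off_supp
  card_on_supp.
rewrite -![g x *+ _]mulr_natl natrB ?weight_leq // -mul2n natrM -/(g x).
by ring.
Qed.

Lemma invariant_cover : perm_invariant cover_mx.
Proof.
apply: (@invariant_of_type _ _ _ (fun a b o => ((b == a.+1) && (o == a))%:R)).
by move=> x y; rewrite entry_adjacency inE.
Qed.

Lemma supported_coverT_mul M a b :
  supported M a b -> supported (cover_mx^T *m M) a.+1 b.
Proof.
move=> sM x y /entry_mul_neq0[z];
  rewrite entry_tr entry_adjacency pnatr_eq0 eqb0 negbK.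
by rewrite inE /= => /andP[/eqP-> _] /sM[-> ->].
Qed.

(** * Harmonic matrices *)

Lemma sum_off_overlap x y (a b : C) :
  \sum_(m | ~~ tnth x m) (if tnth y m then a else b) =
  a *+ (weight y - overlap x y) +
  b *+ (n + overlap x y - (weight x + weight y)).
Proof.
rewrite (bigID (fun m => tnth y m)) /=; congr (_ + _).
  under eq_bigr => m /andP[_ ->] do [].
  rewrite sumr_const; congr (_ *+ _).
  rewrite /overlap setIC -cardsD; apply: eq_card => m; rewrite !inE.
  by rewrite unfold_in.
under eq_bigr => m /andP[_ /negPf ->] do [].
rewrite sumr_const; congr (_ *+ _).
have -> : (n + overlap x y - (weight x + weight y) =
    n - #|supp x :|: supp y|)%N.
  by have := cardsUI (supp x) (supp y); rewrite /weight /overlap; lia.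
have := cardsC (supp x :|: supp y); rewrite card_ord => eC.
have -> : (n - #|supp x :|: supp y| = #|~: (supp x :|: supp y)|)%N by lia.
by apply: eq_card => m; rewrite !inE unfold_in negb_or.
Qed.

(** The solution with value 1 at t = 0 of the recurrence [harmonic_coefS] that
    the equation W H = 0 imposes on the entries of H at pairs of words of
    weight h and overlap h - t. *)
Definition harmonic_coef (h t : nat) : C := (-1) ^+ t / 'C(n - h, t)%:R.

Lemma harmonic_coefS h t : (t < n - h)%N ->
  harmonic_coef h t *+ t.+1 + harmonic_coef h t.+1 *+ (n - h - t) = 0.
Proof.
move=> lt; rewrite /harmonic_coef exprS.
have c0 : 'C(n - h, t)%:R != 0 :> C by rewrite pnatr_eq0 -lt0n bin_gt0 ltnW.
have c1 : 'C(n - h, t.+1)%:R != 0 :> C by rewrite pnatr_eq0 -lt0n bin_gt0.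
have : t.+1%:R * 'C(n - h, t.+1)%:R = (n - h - t)%:R * 'C(n - h, t)%:R :> C.
  by rewrite -!natrM mul_bin_left.
rewrite -[X in X + _]mulr_natr -[X in _ + X]mulr_natr.
move: c0 c1; move: ((-1) ^+ t) => s.
move: ('C(n - h, t)%:R : C) ('C(n - h, t.+1)%:R : C) => b0 b1.
move: (t.+1%:R : C) ((n - h - t)%:R : C) => u v b0_neq0 b1_neq0 e.
apply: (mulIf b0_neq0); apply: (mulIf b1_neq0).
transitivity (s * (u * b1 - v * b0)); first by field; rewrite ?b0_neq0 ?b1_neq0.
by rewrite e subrr !mul0r mulr0.
Qed.

Definition harmonic_mx (h : nat) : mx :=
  \matrix_(a, b) let x := enum_val a in let y := enum_val b in
    if (weight x == h) && (weight y == h)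
    then harmonic_coef h (h - overlap x y) else 0.

Lemma entry_harmonic h x y : entry (harmonic_mx h) x y =
  if (weight x == h) && (weight y == h)
  then harmonic_coef h (h - overlap x y) else 0.
Proof. by rewrite /entry mxE !enum_rankK. Qed.

Lemma invariant_harmonic h : perm_invariant (harmonic_mx h).
Proof.
exact: (@invariant_of_type _ _ _ (fun a b o =>
  if (a == h) && (b == h) then harmonic_coef h (h - o) else 0)) (entry_harmonic
    h).
Qed.

Lemma supported_harmonic h : supported (harmonic_mx h) h h.
Proof.
move=> x y; rewrite entry_harmonic.
by case: andP => [[/eqP-> /eqP->]|]; rewrite ?eqxx.
Qed.

Lemma harmonic_tr h : (harmonic_mx h)^T = harmonic_mx h.
Proof.
by apply/entryP => x y; rewrite entry_tr !entry_harmonic overlapC andbC.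
Qed.

Lemma cover_harmonic h : (h.*2 <= n)%N -> cover_mx *m harmonic_mx h = 0.
Proof.
move=> hn; apply/entryP => x y; rewrite entry_cover_mul [RHS]mxE.
have [/andP[/eqP wx /eqP wy]|nw] :=
  boolP (((weight x).+1 == h) && (weight y == h)).
  pose t := (h - overlap x y).-1.
  have ho := overlap_leql x y.
  rewrite (eq_bigr (fun m =>
      if tnth y m then harmonic_coef h t else harmonic_coef h t.+1)).
    rewrite sum_off_overlap wy.
    have -> : (h - overlap x y = t.+1)%N by rewrite /t; lia.
    have -> : (n + overlap x y - (weight x + h) = n - h - t)%N by rewrite /t;
      lia.
    by apply: harmonic_coefS; rewrite /t; lia.
  move=> m xm; rewrite entry_harmonic weight_flip1 // wx wy !eqxx overlap_flip1
    //=.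
  by case: (tnth y m); congr harmonic_coef; rewrite /t; lia.
by apply: big1 => m xm; rewrite entry_harmonic weight_flip1 // (negPf nw).
Qed.

(** Let x be a word of weight h with overlap h - t - 1 with y, and x' be x with
    a one outside y erased.  The entry of W M at (x', y) sums M over the words
    covering x', which have overlap h - t or h - t - 1 with y; as it vanishes,
    the value of M at overlap h - t determines the one at h - t - 1. *)
Lemma harmonic_unique h M : (h.*2 <= n)%N ->
    supported M h h -> perm_invariant M -> cover_mx *m M = 0 ->
  M = entry M (segment n 0 h) (segment n 0 h) *: harmonic_mx h.
Proof.
move=> hn sM iM WM; set x0 := segment n 0 h; set c := entry M x0 x0.
have wx0 : weight x0 = h by rewrite weight_segment ?subn0 //; lia.
apply/entryP => x y; rewrite entryZ entry_harmonic.
case: andP => [[/eqP wx /eqP wy]|nw]; last first.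
  by rewrite mulr0; apply/eqP/negbNE/negP => /sM[ex ey];
    rewrite ex ey eqxx in nw; apply: nw.
have ho := overlap_leql x y; rewrite wx in ho.
move: {2}(h - _)%N (erefl (h - overlap x y)%N) => t.
elim: t x y wx wy ho => [|t IH] x y wx wy ho et.
  have exy : x = y by apply: overlap_eq; lia.
  rewrite et /harmonic_coef expr0 bin0 divr1 mulr1 -exy.
  by apply: invariant_pair_type; rewrite ?overlapxx ?wx ?wx0.
have [a]: exists a, a \in supp x :\: supp y.
  apply/card_gt0P; have := cardsID (supp y) (supp x).
  by move: et wx; rewrite /overlap /weight; lia.
rewrite !inE => /andP[ya xa]; set x' := flip x a.
have wx' : (weight x').+1 = h by rewrite weight_flip0.
have ox' : overlap x' y = overlap x y.
  by rewrite (overlap_flip0 y xa) (negPf ya) addn0.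
have : entry (cover_mx *m M) x' y = 0 by rewrite WM /entry mxE.
rewrite entry_cover_mul.
rewrite (eq_bigr (fun m =>
    if tnth y m then c * harmonic_coef h t else entry M x y)).
  rewrite sum_off_overlap wy ox' et.
  have -> : (n + overlap x y - (weight x' + h) = n - h - t)%N by lia.
  have ht : (t < n - h)%N by lia.
  have := congr1 ( *%R c) (harmonic_coefS ht);
    rewrite mulrDr !mulrnAr mulr0 => <-.
  by move/addrI/pmulrnI => -> //; lia.
move=> m xm; have := overlap_flip1 y xm; case: ifP => ym;
  rewrite ?addn0 ?addn1 => eo.
  have et' : (h - overlap (flip x' m) y)%N = t by rewrite eo ox'; lia.
  by rewrite IH ?et' ?(weight_flip1 xm) //; lia.
by apply: invariant_pair_type; rewrite ?(weight_flip1 xm) ?wx' ?wx ?eo ?ox'.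
Qed.

Definition harmonic_norm h : C :=
  entry (harmonic_mx h *m harmonic_mx h) (segment n 0 h) (segment n 0 h).

Lemma harmonic_sqr h : (h.*2 <= n)%N ->
  harmonic_mx h *m harmonic_mx h = harmonic_norm h *: harmonic_mx h.
Proof.
move=> hn; apply: harmonic_unique => //.
- exact: supported_mul (@supported_harmonic h) (@supported_harmonic h).
- exact: invariant_mul (@invariant_harmonic h) (@invariant_harmonic h).
- by rewrite mulmxA cover_harmonic // mul0mx.
Qed.

(** The matrix is real and symmetric, so the diagonal entries of its square are
    sums of squares. *)
Lemma harmonic_norm_neq0 h : (h <= n)%N -> harmonic_norm h != 0.
Proof.
move=> hn; set x0 := segment n 0 h.
have wx0 : weight x0 = h by rewrite weight_segment ?subn0.
rewrite /harmonic_norm entry_mul (bigD1 x0) //= gt_eqF // ltr_pwDl //.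
  rewrite entry_harmonic wx0 eqxx overlapxx wx0 subnn /harmonic_coef bin0 expr0
    divr1 mulr1.
  exact: ltr01.
apply: sumr_ge0 => z _; rewrite !entry_harmonic wx0 eqxx andbT /= (overlapC z).
case: eqP => _; rewrite ?mulr0 // /harmonic_coef mulrACA -exprD addnn -mul2n
  exprM sqrrN.
by rewrite !expr1n mul1r mulr_ge0 // invr_ge0.
Qed.

Definition harmonic_proj h : mx := (harmonic_norm h)^-1 *: harmonic_mx h.

Lemma harmonic_proj_idem h : (h.*2 <= n)%N ->
  harmonic_proj h *m harmonic_proj h = harmonic_proj h.
Proof.
move=> hn; rewrite /harmonic_proj -scalemxAl -scalemxAr harmonic_sqr //
  !scalerA.
by rewrite -mulrA mulVf ?mulr1 // harmonic_norm_neq0; lia.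
Qed.

Lemma harmonic_proj_tr h : (harmonic_proj h)^T = harmonic_proj h.
Proof. by rewrite /harmonic_proj linearZ /= harmonic_tr. Qed.

Lemma cover_harmonic_proj h : (h.*2 <= n)%N -> cover_mx *m harmonic_proj h = 0.
Proof. by move=> hn; rewrite /harmonic_proj -scalemxAr cover_harmonic //
  scaler0. Qed.

Lemma harmonic_proj_neq0 h : (h <= n)%N -> harmonic_proj h != 0.
Proof.
move=> hn; set x0 := segment n 0 h.
have wx0 : weight x0 = h by rewrite weight_segment ?subn0.
apply: contraTneq (isT) => /(congr1 (fun M => entry M x0 x0)).
rewrite entryZ entry_harmonic wx0 eqxx overlapxx wx0 subnn /harmonic_coef bin0
  expr0 divr1 mulr1 /=.
by rewrite [RHS]mxE => /eqP; rewrite invr_eq0 (negPf (harmonic_norm_neq0 hn)).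
Qed.

(** * Construction of the matrices E *)

(** The h-th isotypic component, moved from weight h up to weight h + a.
    The index a is a number of steps so that the Gram matrices below can be
    computed by induction. *)
Definition tower h a : mx := iter a (mulmx cover_mx^T) (harmonic_proj h).

Lemma supported_tower h a : supported (tower h a) (h + a) h.
Proof.
elim: a => [|a IH]; first by rewrite addn0; apply/supportedZ/supported_harmonic.
by rewrite addnS; apply: supported_coverT_mul.
Qed.

Lemma invariant_tower h a : perm_invariant (tower h a).
Proof.
elim: a => [|a IH]; first exact/invariantZ/invariant_harmonic.
exact/invariant_mul/IH/invariant_tr/invariant_cover.
Qed.

Definition step_norm (h a : nat) : C := a%:R * (n%:R - h.*2%:R - a%:R + 1).

(** Each use of the commutation relation contributes n - 2(h + t) for
    t = 0, ..., a, and these numbers add up to [step_norm]. *)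
Lemma cover_tower h a : (h.*2 <= n)%N ->
  cover_mx *m tower h a.+1 = step_norm h a.+1 *: tower h a.
Proof.
move=> hn; elim: a => [|a IH].
  rewrite /= (cover_commutator (b := h) (d := h));
    last exact/supportedZ/supported_harmonic.
  rewrite cover_harmonic_proj // mulmx0 add0r; congr (_ *: _);
    rewrite /step_norm; ring.
rewrite [tower h a.+2]/= (cover_commutator (@supported_tower h a.+1)) IH.
rewrite -scalemxAr -[cover_mx^T *m tower h a]/(tower h a.+1) -scalerDl;
  congr (_ *: _).
rewrite /step_norm -!mul2n !natrM natrD -[a.+2]addn1 -[a.+1]addn1 !natrD; ring.
Qed.

Definition tower_norm h a : C := \prod_(t < a) step_norm h t.+1.

Lemma tower_norm_gt0 h a : (h.*2 + a <= n)%N -> 0 < tower_norm h a.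
Proof.
move=> ha; apply: prodr_gt0 => t _; rewrite /step_norm mulr_gt0 ?ltr0n //.
have -> : n%:R - h.*2%:R - t.+1%:R + 1 = (n - h.*2 - t)%:R :> C.
  by have := ltn_ord t => lt; rewrite !natrB; [rewrite -natr1; ring|lia|lia].
by rewrite ltr0n; have := ltn_ord t; lia.
Qed.

Lemma iter_coverZ b (c : C) M :
  iter b (mulmx cover_mx) (c *: M) = c *: iter b (mulmx cover_mx) M.
Proof. by elim: b => //= b ->; rewrite -scalemxAr. Qed.

Lemma iter_cover_tower h a : (h.*2 <= n)%N ->
  iter a (mulmx cover_mx) (tower h a) = tower_norm h a *: harmonic_proj h.
Proof.
move=> hn; elim: a => [|a IH]; first by rewrite /tower_norm big_ord0 scale1r.
by rewrite iterSr cover_tower // iter_coverZ IH scalerA /tower_norm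
  big_ord_recr mulrC.
Qed.

Lemma iter_cover_tower0 h a b : (h.*2 <= n)%N -> (a < b)%N ->
  iter b (mulmx cover_mx) (tower h a) = 0.
Proof.
move=> hn; elim: a b => [|a IH] [|b] // ab.
  by rewrite iterSr cover_harmonic_proj //; elim: b {ab} => //= b ->;
    rewrite mulmx0.
by rewrite iterSr cover_tower // iter_coverZ IH ?scaler0.
Qed.

Lemma tower_tr_mul h b M :
  (tower h b)^T *m M = harmonic_proj h *m iter b (mulmx cover_mx) M.
Proof.
elim: b M => [|b IH] M; first by rewrite harmonic_proj_tr.
by rewrite iterSr -IH [tower h b.+1]/= trmx_mul trmxK mulmxA.
Qed.

Lemma tower_gram h a : (h.*2 <= n)%N ->
  (tower h a)^T *m tower h a = tower_norm h a *: harmonic_proj h.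
Proof.
by move=> hn; rewrite tower_tr_mul iter_cover_tower // -scalemxAr
  harmonic_proj_idem.
Qed.

Lemma tower_orthogonal h h' a a' : (h.*2 <= n)%N -> (h'.*2 <= n)%N ->
  (h + a = h' + a')%N -> h != h' -> (tower h a)^T *m tower h' a' = 0.
Proof.
move=> hn; wlog lt : h h' a a' hn / (h < h')%N => [H hn' e nh|hn' e _].
  have [/H|lt|/eqP] := ltngtP h h'; [exact|idtac|by rewrite (negPf nh)].
  by apply: trmx_inj; rewrite trmx_mul trmxK trmx0 H // eq_sym.
by rewrite tower_tr_mul iter_cover_tower0 ?mulmx0 //; lia.
Qed.

Lemma tower_mul_harmonic_proj h a : (h.*2 <= n)%N ->
  tower h a *m harmonic_proj h = tower h a.
Proof.
move=> hn; elim: a => [|a IH]; first exact: harmonic_proj_idem.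
by rewrite [tower h a.+1]/= -mulmxA IH.
Qed.

(** For h <= min(i, n - i, j, n - j) both square roots are those of positive
    numbers, by [tower_norm_gt0]. *)
Definition eigen_mx (i j : 'I_n.+1) (h : nat) : mx :=
  (sqrtC (tower_norm h (i - h)) * sqrtC (tower_norm h (j - h)))^-1 *:
    (tower h (i - h) *m (tower h (j - h))^T).

Lemma supported_eigen_mx i j h :
  (h <= C2_d i j)%N -> supported (eigen_mx i j h) i j.
Proof.
rewrite /C2_d => hd; apply/supportedZ.
have -> : (i : nat) = (h + (i - h))%N by lia.
have {2}-> : (j : nat) = (h + (j - h))%N by lia.
rewrite !addKn.
exact: supported_mul (@supported_tower h _) (supported_tr (@supported_tower h
  _)).
Qed.

Lemma invariant_eigen_mx i j h : perm_invariant (eigen_mx i j h).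
Proof.
by apply/invariantZ/invariant_mul/invariant_tr; apply: invariant_tower.
Qed.

Lemma eigen_mx_tr i j h : (eigen_mx i j h)^T = eigen_mx j i h.
Proof. by rewrite /eigen_mx linearZ /= trmx_mul trmxK mulrC. Qed.

(** In the middle of the product stands a Gram matrix of two towers at weight j,
    which is zero if the components differ and a multiple of the harmonic
    projection otherwise. *)
Lemma eigen_mx_mul i j i' j' l l' : (l <= C2_d i j)%N -> (l' <= C2_d i' j')%N ->
  eigen_mx i j l *m eigen_mx i' j' l' =
  ((j == i') && (l == l'))%:R *: eigen_mx i j' l.
Proof.
move=> hl hl'; have hl2 := hl; have hl2' := hl'; rewrite /C2_d in hl2 hl2'.
case: eqP => [ej|nj] /=; last first.
  rewrite scale0r; apply: supported_mul0 (supported_eigen_mx hl)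
    (supported_eigen_mx hl') _.
  by move/val_inj.
subst i'; rewrite /eigen_mx -scalemxAl -scalemxAr -mulmxA [X in _ *m X]mulmxA.
case: eqP => [el|nl]; last first.
  rewrite tower_orthogonal ?mul0mx ?mulmx0 ?scaler0 /= ?scale0r //; try lia.
subst l'; rewrite scale1r tower_gram; last by lia.
rewrite -scalemxAl -scalemxAr mulmxA tower_mul_harmonic_proj; last by lia.
rewrite !scalerA; congr (_ *: _).
have pos (k : 'I_n.+1) : (l <= k)%N -> (l <= n - k)%N ->
    sqrtC (tower_norm l (k - l)) != 0.
  by move=> h1 h2; have hk := ltn_ord k;
    rewrite sqrtC_eq0 gt_eqF // tower_norm_gt0 //; lia.
have p1 : sqrtC (tower_norm l (i - l)) != 0 by apply: pos; lia.
have p2 : sqrtC (tower_norm l (j - l)) != 0 by apply: pos; lia.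
have p3 : sqrtC (tower_norm l (j' - l)) != 0 by apply: pos; lia.
move: p1 p2 p3 (sqrtCK (tower_norm l (j - l))).
move: (sqrtC _) (sqrtC (tower_norm l (j - l))) (sqrtC _) =>
  s1 s2 s3 p1 p2 p3 <-.
by field; rewrite p1 p2 p3.
Qed.

(** Pulling the matrix back to weight h gives a nonzero multiple of the harmonic
    projection. *)
Lemma eigen_mx_diag_neq0 i h : (h <= minn i (n - i))%N -> eigen_mx i i h != 0.
Proof.
move=> hi; have lei := ltn_ord i; have hn : (h.*2 <= n)%N by lia.
have K0 : tower_norm h (i - h) != 0 by rewrite gt_eqF // tower_norm_gt0 //; lia.
have hle : (h <= n)%N by lia.
apply: contraNneq (harmonic_proj_neq0 hle) => eE0.
have : (tower h (i - h))^T *m eigen_mx i i h *m tower h (i - h) = 0.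
  by rewrite eE0 mulmx0 mul0mx.
rewrite /eigen_mx -scalemxAr -scalemxAl -!mulmxA tower_gram // mulmxA
  tower_gram //.
rewrite -scalemxAl -scalemxAr harmonic_proj_idem //;
  move: (harmonic_proj h) => Q.
rewrite !scalerA => /eqP; rewrite scaler_eq0 => /orP[|//];
  rewrite !mulf_eq0 invr_eq0 mulf_eq0.
by rewrite !sqrtC_eq0 (negPf K0).
Qed.

(** The entry counts the chains from the empty set to supp x. *)
Lemma entry_tower0 a x y :
  entry (tower 0 a) x y =
  if (weight x == a) && (weight y == 0%N) then a`!%:R else 0.
Proof.
elim: a x => [|a IH] x.
  have w0 : weight (segment n 0 0) = 0%N by rewrite weight_segment.
  have -> : entry (tower 0 0) x y = entry (harmonic_mx 0) x y.
    rewrite entryZ /harmonic_norm entry_mul (bigD1 (segment n 0 0)) //= big1.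
      by rewrite entry_harmonic w0 /harmonic_coef sub0n bin0 divr1 expr0 mulr1
        addr0 invr1 mul1r.
    move=> z nz; rewrite entry_harmonic; case: eqP => [_|];
      last by rewrite mul0r.
    by case: eqP => [/weight0_segment ez|];
      [rewrite ez eqxx in nz|rewrite mul0r].
  by rewrite entry_harmonic /harmonic_coef sub0n bin0 divr1 expr0 fact0.
rewrite [tower 0 a.+1]/= entry_coverT_mul (eq_bigr (fun=>
    if ((weight x).-1 == a) && (weight y == 0%N) then a`!%:R else 0));
      last first.
  by move=> m xm; rewrite IH -(weight_flip0 xm).
rewrite sumr_const card_on_supp; case: (eqVneq (weight x) a.+1) => [->|nx] /=.
  rewrite eqxx /=; case: eqP => _; last by rewrite mul0rn.
  by rewrite -mulrnA factS mulnC.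
case: eqP => [e|]; last by rewrite mul0rn.
by have -> : weight x = 0%N by lia.
Qed.

(** Comparing the only nonzero entry on both sides of [tower_gram] for h = 0
    avoids computing the product in [tower_norm]. *)
Lemma tower_norm0 i : tower_norm 0 i = #|C2_fiber i|%:R * i`!%:R ^+ 2.
Proof.
have /(congr1 (fun M => entry M (segment n 0 0) (segment n 0 0))) :=
  @tower_gram 0 i isT.
have w0 : weight (segment n 0 0) = 0%N by rewrite weight_segment.
rewrite entryZ -[harmonic_proj 0]/(tower 0 0) entry_tower0 w0 eqxx /= fact0
  mulr1 => <-.
rewrite entry_mul mulr_natl -sumr_const [RHS]big_mkcond /=;
  apply: eq_bigr => z _.
rewrite entry_tr !entry_tower0 w0 eqxx andbT mem_fiber.
by case: eqP => _; rewrite ?mulr0.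
Qed.

Lemma eigen_mx0 i j : eigen_mx i j 0 =
  (sqrtC (#|C2_fiber i| * #|C2_fiber j|)%:R)^-1 *:
    adjacency C (setX (C2_fiber i) (C2_fiber j)).
Proof.
apply/entryP => x y; rewrite !entryZ !subn0 entry_adjacency.
rewrite inE !mem_fiber entry_mul (bigD1 (segment n 0 0)) //= big1 ?addr0;
  last first.
  move=> z nz; rewrite entry_tower0; case: eqP => [_|]; last by rewrite mul0r.
  case: eqP => [wz|]; last by rewrite mul0r.
  by case/eqP: nz; apply: weight0_segment.
have w0 : weight (segment n 0 0) = 0%N by rewrite weight_segment.
rewrite entry_tr !entry_tower0 w0 eqxx !andbT.
case: eqP => _ /=; last by rewrite mul0r !mulr0.
case: eqP => _ /=; last by rewrite !mulr0.
have f0 (k : 'I_n.+1) : (k`!%:R : C) != 0 by rewrite pnatr_eq0 -lt0n fact_gt0.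
have X0 (k : 'I_n.+1) : sqrtC (#|C2_fiber k|%:R : C) != 0.
  have [x' ex] := C2_fiber_nonempty k.
  by rewrite sqrtC_eq0 pnatr_eq0 -lt0n; apply/card_gt0P; exists x';
    rewrite mem_fiber ex.
have eK (k : 'I_n.+1) :
    sqrtC (tower_norm 0 k) = sqrtC #|C2_fiber k|%:R * k`!%:R.
  by rewrite tower_norm0 sqrtCM ?nnegrE ?exprn_ge0 ?ler0n // sqrCK ?ler0n.
rewrite !eK natrM sqrtCM ?nnegrE ?ler0n //.
by field; rewrite ?f0 ?X0.
Qed.

(** Multiplying a linear relation among the E_h^(i,j) by E_h^(j,i) isolates its
    h-th coefficient, by (B4); so they are free, and there are as many of them
    as relations spanning the block. *)
Lemma eigen_mx_eigen_matrices : eigen_matrices (C2 n) eigen_mx.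
Proof.
split.
- exact: eigen_mx0.
- move=> i j.
  have nthE (h : 'I_(rtilde (C2 n) i j).+1) :
      (E_tuple (C2 n) eigen_mx i j)`_h = eigen_mx i j h.
    by rewrite -tnth_nth tnth_mktuple.
  have hd (h : 'I_(rtilde (C2 n) i j).+1) : (h <= C2_d i j)%N.
    by rewrite -rtilde_C2 leq_ord.
  rewrite basisEfree; apply/and3P; split.
  + apply/freeP => c e h.
    have : (\sum_h' c h' *: (E_tuple (C2 n) eigen_mx i j)`_h') *m
        eigen_mx j i h = 0.
      by rewrite e mul0mx.
    rewrite mulmx_suml (bigD1 h) // big1 /= ?addr0 => [|h' nh]; last first.
      rewrite -scalemxAl nthE eigen_mx_mul //; last by rewrite C2_d_sym.
      by rewrite eqxx /= (_ : _ == _ = false) ?scale0r ?scaler0 //;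
        apply/negbTE.
    rewrite -scalemxAl nthE eigen_mx_mul //; last by rewrite C2_d_sym.
    rewrite !eqxx scale1r => /eqP; rewrite scaler_eq0 => /orP[/eqP//|].
    by rewrite (negPf (eigen_mx_diag_neq0 _)) //; have := hd h; rewrite /C2_d;
      lia.
  + apply/span_subvP => M /tnthP[h ->]; rewrite tnth_mktuple.
    by apply: mem_A_space; [apply: supported_eigen_mx|apply:
      invariant_eigen_mx].
  + apply: leq_trans (dim_span _) _.
    by rewrite size_map size_tuple C2_block_range size_iota rtilde_C2.
- by move=> i j l _; apply: eigen_mx_tr.
- split=> [i j j' l|i j i' j' l l']; rewrite !rtilde_C2;
  first by rewrite /C2_d; lia.
  exact: eigen_mx_mul.
Qed.

End Cover.

Unset Implicit Arguments.

Theorem theorem5p6 (R : realType) (n : nat) (n_gt0 : (0 < n)%N) :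
  P_polynomial (C2 n) R[i].
Proof.
split.
- exact: C2_coherent.
- exact: C2_well_numbered.
- exact: C2_symmetric_fibers.
- by exists (@eigen_mx n R[i]); apply: eigen_mx_eigen_matrices.
- by move=> E eigE i j; apply: C2_P_polynomial_block.
Qed.
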